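(* Let $T:\mathbb{T}\to\mathbb{T}$, $T(x)=qx \bmod 1$ for an integer $q\ge 2$, and let $f=\log|\varphi|$, where $\varphi:\mathbb{T}\to\mathbb{R}$ is a (real) analytic function having a finite number of zeros. Then $$\sup_{\mu\in\mathcal{M}_T}\int\log|\varphi|\,d\mu=\sup_{\mu\in\mathcal{P}_T}\int\log|\varphi|\,d\mu,$$ where $\mathcal{M}_T$ is the set of all $T$-invariant Borel probability measures on $\mathbb{T}$ and $\mathcal{P}_T$ is the set of all $T$-invariant probability measures supported on periodic orbits of $T$.
   Context: $\mathbb{T}=\mathbb{R}/\mathbb{Z}$. Integrals of $\log|\varphi|$ may take the value $-\infty$. *)

(* Defs.v *)
(* The circle T = R/Z is represented by the
   fundamental domain [0,1) inside R; Borel measures on T are Borel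
   probability measures on R giving full mass to [0,1). *)
From HB Require Import structures.
From mathcomp Require Import all_boot all_order all_algebra.
From mathcomp Require Import all_classical all_reals all_analysis.
Set Implicit Arguments. Unset Strict Implicit. Unset Printing Implicit Defensive.
Import Order.TTheory GRing.Theory Num.Theory.
Import numFieldNormedType.Exports.
Local Open Scope classical_set_scope.
Local Open Scope ring_scope.

Section Defs.
Variable R : realType.

Definition circle : set R := [set x | 0 <= x < 1].

Definition Tmap (q : nat) (x : R) : R :=
  q%:R * x - (Num.floor (q%:R * x))%:~R.

Definition real_analytic (f : R -> R) : Prop :=
  forall x0 : R, exists r : R, 0 < r /\ exists a : nat -> R,
    forall x : R, `|x - x0| < r ->
      (fun n : nat => \sum_(0 <= k < n) a k * (x - x0) ^+ k) @ \oo --> f x.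

Definition circle_analytic (phi : R -> R) : Prop :=
  (forall x, phi (x + 1) = phi x) /\ real_analytic phi.

Definition finitely_many_zeros (phi : R -> R) : Prop :=
  finite_set [set x | circle x /\ phi x = 0].

Definition logabs (phi : R -> R) (x : R) : \bar R :=
  if phi x == 0 then -oo%E else (ln `|phi x|)%:E.

Definition invariant_measures (q : nat) : set (probability R R) :=
  [set mu | mu circle = 1%E /\
     forall A : set R, measurable A -> mu (Tmap q @^-1` A) = mu A].

Definition periodic_measures (q : nat) : set (probability R R) :=
  [set mu | invariant_measures q mu /\
     exists x : R, exists n : nat, circle x /\ (0 < n)%N /\
       iter n (Tmap q) x = x /\
       mu [set iter k (Tmap q) x | k in [set k : nat | (k < n)%N]] = 1%E].

Definition sup_integral (M : set (probability R R)) (f : R -> \bar R) : \bar R :=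
  ereal_sup [set (\int[mu]_x f x)%E | mu in M].

End Defs.

(* Main.v *)
(* Only periodicity and a Lipschitz bound for [phi] matter.  Let [I] be the integral of
   [ln |phi|] against an invariant measure [mu], finite without loss of generality.
   Integrating a Birkhoff sum of length [N] produces an orbit segment along which
   [ln |phi| - I + e] sums to at least a constant times [N], while few times [b] are bad,
   where [b] is bad if some earlier point [T^k x] has
   [ln |phi (T^k x)| < - M - c (b - k)].  Cut the circle into [K] short arcs.
   Removing the bad times and at most one step per arc splits the segment into at
   most [K] loops that end at a good time in the arc where they started; for [N] large,
   one of them has a sum larger than the shadowing error.  The periodic point
   shadowing this loop is exponentially close to it, backwards from the end, and
   goodness of the end time keeps [|phi|] much larger than this distance, so [ln |phi|]
   changes by a bounded total amount. *)
Require Import Defs.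
From HB Require Import structures.
From mathcomp Require Import all_boot all_order all_algebra.
From mathcomp Require Import all_classical all_reals all_analysis.
From mathcomp Require Import measurable_realfun lra ring zify.
Import Order.TTheory GRing.Theory Num.Theory.
Import numFieldNormedType.Exports.
Local Open Scope classical_set_scope.
Local Open Scope ring_scope.
Set Implicit Arguments.
Unset Strict Implicit.
Unset Printing Implicit Defensive.

(** * Lipschitz bounds for periodic analytic functions *)

Lemma sum_nat_geometric_half (R : realFieldType) (n : nat) :
  \sum_(0 <= k < n) k%:R * 2^-1 ^+ k = 2 - 2 * n.+1%:R * 2^-1 ^+ n :> R.
Proof.
elim: n => [|n IHn]; first by rewrite big_geq// expr0; ring.
by rewrite big_nat_recr//= IHn exprS -[n.+2]addn2 -[n.+1]addn1 !natrD; field.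

Qed.

Lemma normr_subrX_le (R : realDomainType) (s u v : R) (k : nat) :
  `|u| <= s -> `|v| <= s ->
  `|u ^+ k.+1 - v ^+ k.+1| <= k.+1%:R * s ^+ k * `|u - v|.
Proof.
move=> us vs; rewrite subrXX normrM mulrC ler_wpM2r//.
apply: le_trans (ler_norm_sum _ _ _) _.
rewrite -[X in X%:R * _](card_ord k.+1) mulr_natl -sumr_const.
apply: ler_sum => i _; rewrite normrM !normrX /= -[X in _ <= s ^+ X](subnK (ltn_ord i : (i <= k)%N)).
by rewrite exprD ler_pM// ?exprn_ge0// lerXn2r// nnegrE (le_trans _ us).
Qed.

(** Convergence at [x0 + s], where [s = r / 2], bounds the terms [a k * s ^+ k] by some [B]. Within
    [s / 2] of [x0], the [k]-th terms at [x] and [y] then differ by at most [2 * B / s * |x - y|]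
    times [k / 2 ^ k], and these weights sum to at most 2. *)
Lemma real_analytic_locally_lipschitz (R : realType) (f : R -> R) (x0 : R) :
  real_analytic f ->
  exists r : R, 0 < r /\ exists L : R, forall x y : R,
    `|x - x0| < r -> `|y - x0| < r -> `|f x - f y| <= L * `|x - y|.
Proof.
move=> /(_ x0)[r [r0 [a af]]].
pose s := r / 2; have s0 : 0 < s by rewrite divr_gt0.
have [B Bs] : exists B : R, forall k, `|a k * s ^+ k| <= B.
  have sr : `|x0 + s - x0| < r.
    by rewrite addrC addKr gtr0_norm// /s ltr_pdivrMr// ltr_pMr// ltr1n.
  have := af _ sr; rewrite addrC addKr => cvf.
  have cva : cvgn (series (fun k => a k * s ^+ k)).
    exact: cvgP cvf.
  have /cvgP/cvg_seq_bounded[M [_ /(_ (M + 1))]] := cvg_series_cvg_0 cva.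
  rewrite ltrDl => /(_ ltr01) MB; exists (M + 1) => k.
  exact: MB.
exists (s / 2); split; first by rewrite divr_gt0.
exists (4 * B / s) => x y xs ys.
have halfs : s / 2 < r.
  by rewrite /s; lra.
have cvxy := cvgB (af x (lt_trans xs halfs)) (af y (lt_trans ys halfs)).
apply: (cvgr_to_le (cvg_norm (cvxy _))); near=> n => /=.
rewrite fctE -sumrB /= (_ : (x - y) = (x - x0) - (y - x0)); last by ring.
move: (x - x0) (y - x0) xs ys => u v us vs.
apply: le_trans (ler_norm_sum _ _ _) _.
have B0 : 0 <= B by apply: le_trans (Bs 0%N).
apply: (@le_trans _ _ (\sum_(0 <= k < n)
    (2 * B / s * `|u - v|) * (k%:R * 2^-1 ^+ k))).
  apply: ler_sum => -[|k] _; first by rewrite !expr0 subrr normr0 mul0r mulr0.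
  rewrite -mulrBr normrM.
  apply: le_trans (ler_wpM2l _ (normr_subrX_le _ (ltW us) (ltW vs))) _ => //.
  have := Bs k.+1; rewrite normrM (ger0_norm (exprn_ge0 _ (ltW s0))) => Bk.
  have -> : `|a k.+1| * (k.+1%:R * (s / 2) ^+ k * `|u - v|) =
    (`|a k.+1| * s ^+ k.+1) * (2 / s * `|u - v| * (k.+1%:R * 2^-1 ^+ k.+1)).
    rewrite exprMn !exprS; field; lra.
  have -> : 2 * B / s * `|u - v| * (k.+1%:R * 2^-1 ^+ k.+1) =
    B * (2 / s * `|u - v| * (k.+1%:R * 2^-1 ^+ k.+1)) by ring.
  by rewrite ler_wpM2r// !mulr_ge0// ?exprn_ge0// ?invr_ge0// ltW.
rewrite -big_distrr/= sum_nat_geometric_half.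
have -> : 4 * B / s * `|u - v| = 2 * B / s * `|u - v| * 2 by ring.
rewrite ler_wpM2l// ?mulr_ge0// ?invr_ge0// ?(ltW s0)//.
by rewrite gerBl !mulr_ge0// exprn_ge0.
Unshelve. all: by end_near. Qed.

Lemma periodic1_intr (R : realType) (T : Type) (phi : R -> T) :
  (forall x, phi (x + 1) = phi x) -> forall x (m : int), phi (x + m%:~R) = phi x.
Proof.
move=> per x m.
have pern n z : phi (z + n%:R) = phi z.
  by elim: n z => [|n IHn] z; rewrite ?addr0// -natr1 addrA per.
case: m => n; first exact: pern.
by rewrite NegzE mulrNz -pmulrn -[in RHS](subrK n.+1%:R x) pern.
Qed.

(** By compactness of [[0, 1]] one large [L] serves everywhere, both as Lipschitz constant and,
    through [L^-1], as the scale that keeps [y] where the local bound holds. *)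
Lemma circle_analytic_lipschitz (R : realType) (phi : R -> R) :
  circle_analytic phi ->
  exists L : R, 0 < L /\ forall x y : R,
    `|x - y| < L^-1 -> `|phi x - phi y| <= L * `|x - y|.
Proof.
move=> [per ana].
have perZ := periodic1_intr per.
have := @segment_compact R 0 1; rewrite compact_near_coveringP => nc.
have {nc} : \forall L \near +oo, `[0, 1] `<=` [set x | forall y : R,
    `|x - y| < L^-1 -> `|phi x - phi y| <= L * `|x - y|].
  apply: (nc R (pinfty_nbhs R) (fun L x => forall y : R,
    `|x - y| < L^-1 -> `|phi x - phi y| <= L * `|x - y|)) => x0 _.
  have [r [r0 [K Kf]]] := real_analytic_locally_lipschitz x0 ana.
  near=> x L => y xy.
  have xr : `|x - x0| < r / 2.
    rewrite distrC; near: x; apply: cvgr_dist_lt; last by rewrite divr_gt0.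
    exact: cvg_id.
  have L0 : 0 < L by near: L; exact: nbhs_pinfty_gt.
  have rL : 2 / r < L by near: L; apply: nbhs_pinfty_gt; rewrite num_real.
  have LK : K < L by near: L; apply: nbhs_pinfty_gt; rewrite num_real.
  apply: le_trans (Kf _ _ _ _) _; first by apply: lt_trans xr _; lra.
    have -> : y - x0 = (x - x0) - (x - y) by ring.
    apply: le_lt_trans (ler_normB _ _) _.
    have : L^-1 < r / 2 by rewrite -[r / 2]invrK ltf_pV2 ?posrE ?invf_div// divr_gt0.
    lra.
  by rewrite ler_wpM2r// ltW.
move=> /(filterI (nbhs_pinfty_gt (num_real 0)))/filter_ex[L [L0 LP]].
exists L; split => // x y xy.
(* Both points are translated by the same integer; this brings [x] into [[0, 1]], while [y] may stay
   outside. *)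
rewrite -(perZ x (- Num.floor x)) -(perZ y (- Num.floor x)) mulrNz.
have -> : x - y = (x - (Num.floor x)%:~R) - (y - (Num.floor x)%:~R) by ring.
apply: LP; last by rewrite opprB addrA subrK.
have := floor_itv x; rewrite /= in_itv/= intrD; lra.
Unshelve. all: by end_near. Qed.

(** * Good times and loops in a finite sequence *)

(* Cutting at the last good return to each colour leaves at most one loop per
   colour, plus one step per colour and one step per bad time. *)
Lemma sum_le_loops (R : realDomainType) (I : finType) (N : nat) (a : nat -> R)
    (good : pred nat) (col : nat -> I) (C L : R) :
  0 <= C -> 0 <= L -> (forall k, (k < N)%N -> a k <= C) ->
  (forall s t, (s < t < N)%N -> good t -> col s = col t ->
    \sum_(s <= k < t) a k <= L) ->
  \sum_(0 <= k < N) a k <=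
    C * \sum_(0 <= k < N) (~~ good k)%:R + #|I|%:R * (C + L).
Proof.
move=> C0 L0 aC loopL; rewrite -cardsT.
have : forall k, (0 <= k < N)%N -> good k -> col k \in [set: I]%SET.
  by move=> k _ _; rewrite finset.in_setT.
have : (0 <= N)%N by [].
have [m] := ubnP (N - 0)%N.
elim: m 0%N [set: I]%SET => // m IHm s D Nsm; rewrite leq_eqVlt => /predU1P[->|sN] colD.
  by rewrite !big_geq// mulr0 add0r mulr_ge0// addr_ge0.
have [gs|bs] := boolP (good s); last first.
  rewrite big_ltn// [X in _ <= _ * X + _]big_ltn// bs mulrDr mulr1 -addrA lerD ?aC//.
  apply: IHm => //; first by lia.
  by move=> k /andP[/ltnW sk kN]; apply: colD; rewrite sk.
pose P t := [&& (s <= t < N)%N, good t & col t == col s].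
have exP : exists t, P t by exists s; rewrite /P leqnn sN gs eqxx.
have PN t : P t -> (t <= N)%N by case/andP => /andP[_ /ltnW].
case: (ex_maxnP exP PN) => t /and3P[/andP[st tN] gt /eqP ct] tmax.
(* The sum splits into the loop from [s] to [t], possibly empty, the step at [t], and a rest whose
   good times avoid the colour of [s] because [t] is maximal. *)
rewrite (big_cat_nat st (ltnW tN))/= [X in _ + X <= _]big_ltn//=.
have colDs : col s \in D by rewrite colD// leqnn.
have -> : #|D|%:R = 1 + #|D :\ col s|%SET%:R :> R.
  by rewrite (cardsD1 (col s) D) colDs natrD.
have h1 : \sum_(s <= k < t) a k <= L.
  move: st; rewrite leq_eqVlt => /predU1P[->|st]; first by rewrite big_geq.
  by apply: loopL => //; rewrite st.
have h2 := aC t tN.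
have h3 : \sum_(t.+1 <= k < N) a k <=
    C * \sum_(t.+1 <= k < N) (~~ good k)%:R + #|D :\ col s|%SET%:R * (C + L).
  apply: IHm => //; first by lia.
  move=> k /andP[tk kN] gk; rewrite in_setD1 colD ?gk ?kN ?(leq_trans st (ltnW tk))// andbT.
  apply/negP => ck; have := tmax k; rewrite /P kN gk ck (leq_trans st (ltnW tk)) => /(_ isT).
  by rewrite leqNgt tk.
have h4 : C * \sum_(t.+1 <= k < N) (~~ good k)%:R <= C * \sum_(s <= k < N) (~~ good k)%:R.
  rewrite ler_wpM2l// (big_cat_nat (leq_trans st (leqnSn t)) tN)/= lerDr.
  by apply: sumr_ge0.
rewrite mulrDl mul1r; lra.
Qed.

(** Bounds how many later times a single point of weight [v] makes bad: the time [j + 1] steps later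
    is affected only if [j + 1 < v / c]. *)
Lemma sum_lt_mul_le (R : realFieldType) (c v : R) (n : nat) :
  0 < c -> 0 <= v -> \sum_(0 <= j < n) (c * j.+1%:R < v)%R%:R <= v / c.
Proof.
move=> c0 v0; elim: n => [|n IHn]; first by rewrite big_geq// divr_ge0// ltW.
have [nv|vn] := ltrP (c * n.+1%:R) v; last first.
  by rewrite big_nat_recr//= ltNge vn addr0.
apply: (@le_trans _ _ n.+1%:R); last by rewrite ler_pdivlMr// mulrC ltW.
rewrite -[n.+1 in X in _ <= X]subn0 -[X in _ <= X]mulr1 mulr_natl -sumr_const_nat.
by apply: ler_sum => j _; case: (c * _ < v)%R.
Qed.

(** Each bad time is charged to every earlier [k] that makes it bad; after exchanging the sums, each
    [k] is charged at most [v k / c] times. *)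
Lemma sum_bad_le (R : realFieldType) (c : R) (v : nat -> R) (N : nat) :
  0 < c -> (forall k, 0 <= v k) ->
  \sum_(0 <= b < N) [exists k : 'I_b, (c * (b - k)%:R < v k)%R]%:R <=
  \sum_(0 <= k < N) v k / c.
Proof.
move=> c0 v0.
apply: (@le_trans _ _ (\sum_(0 <= b < N) \sum_(0 <= k < N | (k < b)%N)
    (c * (b - k)%:R < v k)%R%:R)).
  apply: ler_sum_nat => b /andP[_ bN].
  case: existsP => [[k kb]|_]; last by rewrite sumr_ge0.
  rewrite big_mkcond (bigD1_seq (k : nat)) ?iota_uniq//=; last first.
    by rewrite mem_index_iota (ltn_trans (ltn_ord k)).
  by rewrite ltn_ord kb lerDl sumr_ge0// => i _; case: ifP.
rewrite (exchange_big_dep_nat xpredT)//=.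
apply: ler_sum_nat => k /andP[_ kN].
apply: le_trans (sum_lt_mul_le (N - k.+1) c0 (v0 k)).
rewrite big_mkcond/= (big_cat_nat (leq0n k.+1) kN)/= big_nat big1 ?add0r; last first.
  by move=> b /andP[_ bk]; rewrite ltnNge -ltnS bk.
(* With [b = j + k + 1] the elapsed time [b - k] is [j + 1]. *)
rewrite -[k.+1 in X in X <= _]add0n big_addn; apply: ler_sum => b _.
by rewrite ltn_addl// addnS -addSn addnK.
Qed.

(** Otherwise every loop ending at a good time has sum at most [L]. The decomposition into loops and
    the count of bad times, each costing at most [C], then contradict the assumed lower bound. *)
Lemma exists_good_loop (R : realFieldType) (I : finType) (N : nat) (a v : nat -> R)
    (col : nat -> I) (C L c : R) :
  0 <= C -> 0 <= L -> 0 < c -> (forall k, 0 <= v k) ->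
  (forall k, (k < N)%N -> a k <= C) ->
  #|I|%:R * (C + L) < \sum_(0 <= k < N) (a k - C / c * v k) ->
  exists s t, [/\ (s < t < N)%N, col s = col t, L < \sum_(s <= k < t) a k &
    forall k, (k < t)%N -> v k <= c * (t - k)%:R].
Proof.
move=> C0 L0 c0 v0 aC big.
pose good t := ~~ [exists k : 'I_t, c * (t - k)%:R < v k].
apply: contrapT => noloop; move: big; apply/negP; rewrite -leNgt.
have loopL s t : (s < t < N)%N -> good t -> col s = col t ->
    \sum_(s <= k < t) a k <= L.
  move=> stN gt cst; rewrite leNgt; apply/negP => Lst; apply: noloop.
  exists s, t; split => // k kt; rewrite leNgt; apply/negP => kv.
  by move/negP: gt; apply; apply/existsP; exists (Ordinal kt).
have := sum_le_loops C0 L0 aC loopL.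
have /(ler_wpM2l C0) := sum_bad_le N c0 v0.
rewrite -mulr_suml mulrCA sumrB -mulr_sumr mulrA.
under [X in _ <= _ * X + _ -> _]eq_bigr do rewrite negbK.
lra.
Qed.

(** * Iterates of [Tmap] and shadowing by periodic points *)

Lemma circle_inj_mod1 (R : realType) (x y : R) (m : int) :
  circle x -> circle y -> x = y + m%:~R -> x = y.
Proof.
move=> /andP[x0 x1] /andP[y0 y1] xym.
have fx : Num.floor x = 0 by apply: Num.Theory.floor_def; rewrite /=; lra.
have : Num.floor x = m by apply: Num.Theory.floor_def; rewrite intrD; lra.
by rewrite fx xym => <-; rewrite addr0.
Qed.

Lemma Tmap_circle (R : realType) (q : nat) (x : R) : circle (Tmap q x).
Proof.
rewrite /circle/= /Tmap; set y := _ * x.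
by have := Num.Theory.floor_itv y; rewrite intrD; lra.
Qed.

Lemma iter_TmapE (R : realType) (q k : nat) (x : R) :
  exists m : int, iter k (Tmap q) x = q%:R ^+ k * x + m%:~R.
Proof.
elim: k => [|k [m IHk]]; first by exists 0; rewrite expr0 mul1r addr0.
rewrite iterS IHk /Tmap; set f := Num.floor _.
exists (q%:Z * m - f); rewrite intrD mulrNz intrM exprS -pmulrn; ring.
Qed.

(* If [T^n x = q^n x + m], then [q^n p + m = p] for [p = - m / (q^n - 1)]. *)
Lemma periodic_shadowing (R : realType) (q n : nat) (x : R) :
  (2 <= q)%N -> (0 < n)%N ->
  exists p : R, [/\ circle p, iter n (Tmap q) p = p & forall k, (k <= n)%N ->
    exists m : int, `|iter k (Tmap q) p - iter k (Tmap q) x + m%:~R| <=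
      2 * `|iter n (Tmap q) x - x| / 2 ^+ (n - k)].
Proof.
move=> q2 n0; have [m Tx] := iter_TmapE q n x.
have q2R : 2 <= q%:R :> R by rewrite ler_nat.
have qn2 : 2 <= q%:R ^+ n :> R.
  case: n n0 {Tx} => // n _; rewrite exprS -[2]mulr1 ler_pM// exprn_ege1//; lra.
have qn1 : 0 < q%:R ^+ n - 1 :> R by lra.
pose p' : R := - m%:~R / (q%:R ^+ n - 1).
have p'x : p' - x = (x - iter n (Tmap q) x) / (q%:R ^+ n - 1).
  by rewrite Tx /p'; field; lra.
pose f := Num.floor p'; pose p := p' - f%:~R.
have cp : circle p.
  by rewrite /circle/= /p; have := Num.Theory.floor_itv p'; rewrite intrD; lra.
exists p; split => //.
  have [m' Tp] := iter_TmapE q n p.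
  have cTp : circle (iter n (Tmap q) p) by rewrite -(prednK n0); exact: Tmap_circle.
  apply: (@circle_inj_mod1 _ _ _ (m' - m - (q%:Z ^+ n - 1) * f)) => //.
  rewrite Tp /p !intrD !mulrNz intrM intrD rmorphXn/= /p' -pmulrn; field; lra.
move=> k kn; have [a Ta] := iter_TmapE q k p; have [b Tb] := iter_TmapE q k x.
(* The two iterates are [q^k p + a] and [q^k x + b], and [p = p' - f]; this integer leaves exactly
   [q^k (p' - x)]. *)
exists (b - a + q%:Z ^+ k * f).
have -> : iter k (Tmap q) p - iter k (Tmap q) x + (b - a + q%:Z ^+ k * f)%:~R =
    q%:R ^+ k * (p' - x).
  by rewrite Ta Tb /p !intrD mulrNz intrM rmorphXn/= -pmulrn; ring.
rewrite p'x normrM normrM normfV (gtr0_norm qn1) distrC ger0_norm ?exprn_ge0//.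
set d := `|_ - x|; have d0 : 0 <= d by exact: normr_ge0.
have -> : q%:R ^+ k * (d / (q%:R ^+ n - 1)) = d * (q%:R ^+ k / (q%:R ^+ n - 1)) by ring.
have -> : 2 * d / 2 ^+ (n - k) = d * (2 / 2 ^+ (n - k)) by ring.
rewrite ler_wpM2l// ler_pdivrMr// mulrAC ler_pdivlMr ?exprn_gt0//.
(* [q^k 2^(n-k) <= q^n <= 2 (q^n - 1)], the last inequality because [q^n >= 2]. *)
apply: (@le_trans _ _ (q%:R ^+ k * q%:R ^+ (n - k))).
  by rewrite ler_wpM2l ?exprn_ge0// lerXn2r// nnegrE.
rewrite -exprD subnKC//; lra.
Qed.

(** * Change of [ln |phi|] under shadowing *)

Lemma ln1B_ge (R : realType) (t : R) : 0 <= t <= 2^-1 -> - (2 * t) <= ln (1 - t).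
Proof.
move=> /andP[t0 t1]; have t1' : 0 < 1 - t by lra.
rewrite -[1 - t]invrK lnV ?posrE ?invr_gt0// lerN2.
have -> : (1 - t)^-1 = 1 + t / (1 - t) by field; lra.
have t2 : t / (1 - t) <= 2 * t.
  rewrite ler_pdivrMr//; nra.
apply: le_trans (le_ln1Dx _) t2.
by apply: (@lt_le_trans _ _ 0); rewrite ?divr_ge0// ?ltrN10// ltW.
Qed.

(* The lower bound on [|phi|] decays like [(2 / 3) ^ (n - k)] and the shadowing error
   like [2 ^ - (n - k)], so their ratio is summable along the loop. *)
Lemma ln_shadowing (R : realType) (q n : nat) (x L M d : R) (phi : R -> R) :
  (2 <= q)%N -> (0 < n)%N -> (forall x, phi (x + 1) = phi x) -> 0 < L ->
  (forall x y, `|x - y| < L^-1 -> `|phi x - phi y| <= L * `|x - y|) ->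
  `|iter n (Tmap q) x - x| <= d -> 2 * d < L^-1 -> 4 * L * d * expR M <= 1 ->
  (forall k, (k < n)%N -> phi (iter k (Tmap q) x) != 0) ->
  (forall k, (k < n)%N ->
    - ln `|phi (iter k (Tmap q) x)| - M <= ln (3 / 2) * (n - k)%:R) ->
  exists p : R, [/\ circle p, iter n (Tmap q) p = p & forall k, (k < n)%N ->
    phi (iter k (Tmap q) p) != 0 /\
    ln `|phi (iter k (Tmap q) x)| - (3 / 4) ^+ (n - k) <=
      ln `|phi (iter k (Tmap q) p)|].
Proof.
move=> q2 n0 per L0 Llip Txd dL dM phi0 phiM.
have [p [cp Tp near]] := periodic_shadowing x q2 n0.
exists p; split => // k kn; have [m] := near _ (ltnW kn).
rewrite -[in phi (iter k _ p)](periodic1_intr per _ m).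
move: (phi0 _ kn) (phiM _ kn); set v := iter k _ x; set u := _ + m%:~R.
have -> : iter k (Tmap q) p - v + m%:~R = u - v by rewrite /u; ring.
set j := (n - k)%N => v0 vM uv.
have d0 : 0 <= d by apply: le_trans Txd.
have pv : 0 < `|phi v| by rewrite normr_gt0.
have j2 : 0 < 2 ^+ j :> R by rewrite exprn_gt0.
have uvd : `|u - v| <= 2 * d / 2 ^+ j.
  by apply: le_trans uv _; rewrite ler_wpM2r ?invr_ge0 ?(ltW j2)// ler_wpM2l.
have uvL : `|u - v| < L^-1.
  apply: le_lt_trans uvd (le_lt_trans _ dL).
  by rewrite ler_pdivrMr// ler_peMr ?mulr_ge0// exprn_ege1// ler1n.
(* [t] will bound the relative error of [|phi|] at [v]. The base [3 / 4] is the ratio of [1 / 2] to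
   [2 / 3]; the factor [2^-1] keeps [t] at most [1 / 2] and makes the logarithmic loss [2 * t] equal
   to [(3 / 4) ^+ j]. *)
pose t : R := 2^-1 * (3 / 4) ^+ j.
have t01 : 0 <= t <= 2^-1.
  have j0 : 0 <= (3 / 4 : R) ^+ j by rewrite exprn_ge0.
  have j1 : (3 / 4 : R) ^+ j <= 1 by apply: exprn_ile1; lra.
  rewrite /t; lra.
have tv : 2 * L * d / 2 ^+ j <= t * `|phi v|.
  have phiv_ge : expR (- M) / (3 / 2) ^+ j <= `|phi v|.
    rewrite -ler_ln ?posrE ?divr_gt0 ?exprn_gt0 ?expR_gt0//.
    rewrite lnM ?posrE ?invr_gt0 ?exprn_gt0 ?expR_gt0// lnV ?posrE ?exprn_gt0//.
    rewrite lnXn ?divr_gt0// expRK -[ln (3 / 2) *+ j]mulr_natr; lra.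
  apply: le_trans (ler_wpM2l _ phiv_ge); last by case/andP: t01.
  have -> : t * (expR (- M) / (3 / 2) ^+ j) = (2^-1 * expR (- M)) / 2 ^+ j.
    have -> : (2 : R) ^+ j = (3 / 2) ^+ j / (3 / 4) ^+ j.
      by rewrite -expr_div_n; congr (_ ^+ _); field.
    by rewrite /t; field; rewrite !expf_neq0//; lra.
  rewrite ler_wpM2r ?invr_ge0 ?(ltW j2)// expRN ler_pdivlMr ?expR_gt0//; lra.
have uvt : `|phi v| * (1 - t) <= `|phi u|.
  have := Llip _ _ uvL; have := ler_wpM2l (ltW L0) uvd.
  have := lerB_dist (phi v) (phi u); rewrite distrC.
  have -> : L * (2 * d / 2 ^+ j) = 2 * L * d / 2 ^+ j by ring.
  lra.
have t1 : 0 < 1 - t by lra.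
have pu : 0 < `|phi u| by apply: lt_le_trans uvt; rewrite mulr_gt0.
split; first by rewrite -normr_gt0.
have := uvt; rewrite -ler_ln ?posrE ?mulr_gt0// lnM ?posrE//.
have := ln1B_ge t01; rewrite /t; lra.
Qed.

Lemma sum_geometric_three_quarters (R : realFieldType) (n : nat) :
  \sum_(0 <= k < n) (3 / 4) ^+ (n - k) <= 3 :> R.
Proof.
suff -> : \sum_(0 <= k < n) (3 / 4) ^+ (n - k) = 3 - 3 * (3 / 4) ^+ n :> R.
  by rewrite gerBl mulr_ge0 ?exprn_ge0.
elim: n => [|n IHn]; first by rewrite big_geq// expr0 mulr1 subrr.
rewrite big_nat_recl// subn0; under eq_bigr do rewrite subSS.
by rewrite IHn exprS; field.
Qed.

(** * Continuity, boundedness and measurability *)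

Lemma small_scale_lipschitz_continuous (R : realType) (phi : R -> R) (L : R) :
  0 < L -> (forall x y, `|x - y| < L^-1 -> `|phi x - phi y| <= L * `|x - y|) ->
  continuous phi.
Proof.
move=> L0 lip x; apply/cvgrPdist_lt => e e0; near=> y.
have xyL : `|x - y| < L^-1.
  near: y; apply: cvgr_dist_lt; [exact: cvg_id|by rewrite invr_gt0].
apply: le_lt_trans (lip _ _ xyL) _; rewrite mulrC -ltr_pdivlMr//.
by near: y; apply: cvgr_dist_lt; [exact: cvg_id|rewrite divr_gt0].
Unshelve. all: by end_near. Qed.

Lemma periodic1_continuous_bounded (R : realType) (phi : R -> R) :
  (forall x, phi (x + 1) = phi x) -> continuous phi ->
  exists B : R, 0 < B /\ forall x, `|phi x| <= B.
Proof.
move=> per cphi.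
have cn : {within `[0, 1], continuous (fun x : R => `|phi x|)}.
  by apply: continuous_subspaceT => x; apply: cvg_norm; exact: cphi.
have [c _ cmax] := EVT_max ler01 cn.
exists (`|phi c| + 1); split; first by rewrite ltr_wpDl.
move=> x; rewrite -(periodic1_intr per x (- Num.floor x)) mulrNz.
apply: le_trans (cmax _ _) _; last by rewrite lerDl.
have := Num.Theory.floor_itv x; rewrite in_itv/= intrD; lra.
Qed.

Lemma measurable_Tmap (R : realType) (q : nat) :
  measurable_fun [set: R] (Tmap q : R -> R).
Proof.
have mq : measurable_fun [set: R] (fun x : R => q%:R * x).
  exact: measurable_funM.
have mf : measurable_fun [set: R] (fun y : R => (Num.floor y)%:~R : R).
  by apply: nondecreasing_measurable => // x y xy; rewrite ler_int le_floor.
by apply: measurable_funB => //; exact: measurableT_comp mf mq.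
Qed.

(** * Measure-preserving maps and Birkhoff sums *)

Lemma measurable_iter d (X : measurableType d) (T : X -> X) (k : nat) :
  measurable_fun [set: X] T -> measurable_fun [set: X] (iter k T).
Proof.
move=> mT; elim: k => [|k IHk]; first exact: measurable_id.
exact: (measurableT_comp mT IHk).
Qed.

Section measure_preserving.
Context d (X : measurableType d) (R : realType) (mu : probability X R) (T : X -> X).
Hypothesis mT : measurable_fun [set: X] T.
Hypothesis muT : forall A, measurable A -> mu (T @^-1` A) = mu A.

Lemma measure_preserving_iter (k : nat) (A : set X) :
  measurable A -> mu (iter k T @^-1` A) = mu A.
Proof.
move=> mA; elim: k => // k IHk; rewrite -[RHS]IHk -[RHS]muT//.
  by congr (mu _); apply/seteqP; split => x; rewrite /preimage/= -iterSr.
by rewrite -[X in measurable X]setTI; apply: (measurable_iter _ mT).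
Qed.

Lemma integrable_iter (k : nat) (f : X -> \bar R) :
  mu.-integrable setT f -> mu.-integrable setT (f \o iter k T).
Proof.
move=> /integrableP[mf fi]; have mTk := measurable_iter k mT.
apply/integrableP; split; first exact: measurableT_comp.
rewrite (_ : (\int[mu]_x _ = \int[mu]_x `|f x|)%E)//.
rewrite -(@ge0_integral_pushforward _ _ _ _ _ _ mTk mu setT (abse \o f))//=; last exact: measurableT_comp.
by apply: eq_measure_integral => A mA _; exact: measure_preserving_iter.
Qed.

Lemma integral_iter (k : nat) (f : X -> \bar R) :
  mu.-integrable setT f -> (\int[mu]_x f (iter k T x) = \int[mu]_x f x)%E.
Proof.
move=> fi; have mTk := measurable_iter k mT.
have /integrableP[mf _] := fi.
rewrite -[LHS](@integral_pushforward _ _ _ _ _ _ mTk mu setT f)//; last exact: integrable_iter.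
by apply: eq_measure_integral => A mA _; exact: measure_preserving_iter.
Qed.

(** By invariance the Birkhoff sum has integral [N] times that of [F], and almost every orbit avoids
    [Z]. If the sum were at most [e * N] along all such orbits, integrating would contradict the
    lower bound on the integral of [F]. *)
Lemma exists_sum_iter_gt (F : X -> R) (Z : set X) (e : R) (N : nat) :
  mu.-integrable setT (EFin \o F) -> (e%:E < \int[mu]_x (F x)%:E)%E ->
  measurable Z -> mu Z = 0%E -> (0 < N)%N ->
  exists x, (forall k, (k < N)%N -> ~ Z (iter k T x)) /\
    e * N%:R < \sum_(0 <= k < N) F (iter k T x).
Proof.
move=> Fi eF mZ Z0 N0; apply: contrapT => nox.
pose B := \bigcup_k (iter k T @^-1` Z).
have mTZ k : measurable (iter k T @^-1` Z).
  by rewrite -[X in measurable X]setTI; apply: (measurable_iter _ mT).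
have mB : measurable B by apply: bigcup_measurable.
have B0 : mu B = 0%E.
  apply/(negligibleP mu mB); apply: negligible_bigcup => k.
  apply/(negligibleP mu (mTZ k)); exact: (etrans (measure_preserving_iter k mZ) Z0).
pose G x := (\sum_(0 <= k < N) (F (iter k T x))%:E)%E.
have Gi : mu.-integrable setT G.
  by apply: (integrable_sum measurableT) => k _; exact: (integrable_iter k Fi).
have GE : (\int[mu]_x G x = N%:R%:E * \int[mu]_x (F x)%:E)%E.
  rewrite /G integral_sum//=; last by move=> k; exact: (integrable_iter k Fi).
  under eq_bigr do rewrite (integral_iter _ Fi).
  rewrite -(fineK (integrable_fin_num _ Fi))// sumEFin -EFinM.
  by rewrite sumr_const_nat subn0 mulr_natl.
have : (\int[mu]_x G x <= (e * N%:R)%:E)%E.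
  rewrite (negligible_integral mB)//.
  apply: (@le_trans _ _ (\int[mu]_(x in setT `\` B) (cst (e * N%:R)%:E) x)%E).
    apply: le_integral => //.
    - exact: measurableD.
    - by apply: integrableS Gi => //; exact: measurableD.
    - by apply: finite_measure_integrable_cst; exact: measurableD.
    - move=> x; rewrite inE => -[_ Bx]; rewrite /G sumEFin lee_fin leNgt.
      apply/negP => eN; apply: nox; exists x; split => // k kN Zk.
      by apply: Bx; exists k.
  rewrite integral_cst; last exact: measurableD.
  have B1 : mu (~` B) = 1%E by rewrite probability_setC// B0 sube0.
  rewrite setTD -[leRHS]mule1 -B1; exact: lexx.
rewrite GE -(fineK (integrable_fin_num _ Fi))// -EFinM lee_fin.
apply/negP; rewrite -ltNge mulrC ltr_pM2l ?ltr0n//.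
by rewrite -lte_fin fineK// integrable_fin_num.
Qed.

End measure_preserving.

(** The truncations are dominated by [|g|] and vanish at [x] once [M >= - g x], so dominated
    convergence applies. *)
Lemma exists_tail_integral_lt d (X : measurableType d) (R : realType)
    (mu : {measure set X -> \bar R}) (g : X -> R) (e : R) :
  0 < e -> mu.-integrable setT (EFin \o g) ->
  exists M : nat, mu.-integrable setT (fun x => (Num.max 0 (- g x - M%:R))%:E) /\
    (\int[mu]_x (Num.max 0 (- g x - M%:R))%:E < e%:E)%E.
Proof.
move=> e0 gi; have /integrableP[/measurable_EFinP mg _] := gi.
pose u (M : nat) x := (Num.max 0 (- g x - M%:R))%:E : \bar R.
have mu_ M : measurable_fun setT (u M).
  apply/measurable_EFinP; apply: measurable_maxr => //.
  apply: measurable_funB => //; exact: measurable_funN.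
have ug M x : (`|u M x| <= `|(g x)%:E|)%E.
  rewrite lee_fin ger0_norm ?le_max ?lexx// ge_max normr_ge0/=.
  by rewrite lerBlDr ler_wpDr// -normrN ler_norm.
have ui M : mu.-integrable setT (u M) by apply: le_integrable gi.
have [||||_ _ cv] := @dominated_convergence _ _ _ mu setT measurableT u (cst 0%E)
   (fun x => `|(g x)%:E|)%E mu_.
- exact: measurable_cst.
- apply: aeW => x _; apply/fine_cvgP; split; first by near=> n.
  apply: cvg_near_cst; near=> n; rewrite /= max_l// subr_le0.
  near: n; exists (Num.truncn (- g x)).+1 => // n /= gn.
  by rewrite (le_trans (ltW (truncnS_gt _)))// ler_nat.
- exact: integrable_abse.
- by apply: aeW => x n _; exact: ug.
- move: cv; rewrite /= integral0 => /fine_cvgP[_ /cvgrPdist_lt/(_ _ e0)].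
  move=> [M _ /(_ M (leqnn _))] /=; rewrite sub0r normrN => Me.
  exists M; split; first exact: ui.
  rewrite -(fineK (integrable_fin_num _ (ui M)))// lte_fin.
  exact: le_lt_trans (ler_norm _) Me.
Unshelve. all: by end_near. Qed.

(** * Uniform measure on a periodic orbit *)

Section orbit_measure.
Local Open Scope ereal_scope.
Context d (X : measurableType d) (R : realType) (T : X -> X) (x : X) (n : nat).

(* The orbit has length [n.+1]. *)
Definition orbit_measure : set X -> \bar R :=
  mscale ((n.+1%:R^-1)%:nng : {nonneg R})%R (msum (fun k => \d_(iter k T x)) n.+1).

HB.instance Definition _ := Measure.on orbit_measure.

Lemma orbit_measureE (A : set X) : orbit_measure A =
  (n.+1%:R^-1)%R%:E * \sum_(k < n.+1) \d_(iter k T x) A.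
Proof. by []. Qed.

(** Gives the total mass 1 and, later, full mass to [circle] and to the orbit itself. *)
Lemma orbit_measure_full (A : set X) :
  (forall k, (k < n.+1)%N -> A (iter k T x)) -> orbit_measure A = 1.
Proof.
move=> Ax; rewrite orbit_measureE (eq_bigr (fun=> 1%:E)); last first.
  by move=> k _; rewrite diracE mem_set//; apply: Ax.
rewrite sumEFin -EFinM; congr EFin.
by rewrite sumr_const card_ord mulVf.
Qed.

HB.instance Definition _ := Measure_isProbability.Build d X R orbit_measure
  (orbit_measure_full (fun _ _ => I)).

(** Taking the preimage shifts the sum by one step; periodicity identifies the term that enters with
    the one that leaves. *)
Lemma orbit_measure_preimage (A : set X) : iter n.+1 T x = x ->
  orbit_measure (T @^-1` A) = orbit_measure A.
Proof.
move=> Tx; rewrite !orbit_measureE; congr (_ * _).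
rewrite big_ord_recr big_ord_recl addeC; congr (_ + _).
by rewrite !diracE -[X in _ = ((X \in A)%:R)%:E]Tx.
Qed.

(** [f] may be infinite off the orbit. Its positive and negative parts are integrated separately,
    and both integrals are finite because the values on the orbit are real. *)
Lemma integral_orbit_measure (f : X -> \bar R) (g : nat -> R) :
  measurable_fun setT f ->
  (forall k, (k < n.+1)%N -> f (iter k T x) = (g k)%:E) ->
  \int[orbit_measure]_y f y =
    (n.+1%:R^-1 * \sum_(0 <= k < n.+1) g k)%R%:E.
Proof.
move=> mf fg.
have ge0_int (h : X -> \bar R) : measurable_fun setT h -> (forall y, 0 <= h y) ->
    \int[orbit_measure]_y h y = (n.+1%:R^-1)%R%:E * \sum_(k < n.+1) h (iter k T x).
  move=> mh h0; rewrite /orbit_measure ge0_integral_mscale//= ge0_integral_measure_sum//.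
  congr (_ * _); apply: eq_bigr => k _.
  by rewrite integral_dirac// diracT mul1e.
rewrite integralE !ge0_int//; [|exact: measurable_funeneg|exact: measurable_funepos].
rewrite big_mkord (eq_bigr (fun k : 'I__ => (Num.max (g k) 0)%:E)); last first.
  by move=> k _; rewrite funeposE fg// EFin_max.
rewrite [X in _ - _ * X](eq_bigr (fun k : 'I__ => (Num.max (- g k) 0)%:E)); last first.
  by move=> k _; rewrite funenegE fg// EFin_max.
rewrite !sumEFin -!EFinM -EFinB -mulrBr -sumrB; congr (_ * _)%:E.
apply: eq_bigr => k _; rewrite /Num.max; do 2 case: ifP; lra.
Qed.

End orbit_measure.

(** * Integrability of [ln |phi|] *)

Lemma probability_integral_cst d (X : measurableType d) (R : realType)
    (mu : probability X R) (r : R) : (\int[mu]_x cst r%:E x = r%:E)%E.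
Proof.
by rewrite integral_cst// -[RHS]mule1 -(@probability_setT _ _ _ mu).
Qed.

Lemma measurable_logabs (R : realType) (phi : R -> R) :
  measurable_fun [set: R] phi -> measurable_fun [set: R] (logabs phi).
Proof.
move=> mphi; apply: measurable_fun_ifT => //.
  exact: measurable_fun_eqr.
apply/measurable_EFinP; apply: (measurableT_comp (@measurable_ln R)).
exact: measurableT_comp.
Qed.

(** The positive part is bounded, so its integral is finite; an infinite integral of the negative
    part would make that of [f] equal to [-oo]. *)
Lemma bounded_above_integrable d (X : measurableType d) (R : realType)
    (mu : probability X R) (f : X -> \bar R) (B : R) :
  measurable_fun setT f -> (forall x, (f x <= B%:E)%E) ->
  (\int[mu]_x f x)%E != -oo%E -> mu.-integrable setT f.
Proof.
move=> mf fB intf.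
have mfp := measurable_funepos mf; have mfn := measurable_funeneg mf.
have ip : (\int[mu]_x f^\+ x < +oo)%E.
  apply: (@le_lt_trans _ _ (\int[mu]_x cst (Num.max B 0)%:E x)%E).
    apply: ge0_le_integral => //.
    move=> x _; rewrite funeposE EFin_max ge_max le_max fB/=.
    by rewrite le_max lexx orbT.
  by rewrite probability_integral_cst ltry.
have im : (\int[mu]_x f^\- x < +oo)%E.
  rewrite ltey; apply: contra intf => /eqP im; rewrite integralE im.
  have : (0 <= \int[mu]_x f^\+ x)%E by apply: integral_ge0.
  by move: ip; case: (\int[mu]_x f^\+ x)%E.
apply/integrableP; split => //; rewrite -[X in integral _ _ X]/(abse \o f) fune_abse.
by rewrite ge0_integralD// lte_add_pinfty.
Qed.

Lemma integrable_logabs (R : realType) (phi : R -> R) (mu : probability R R) :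
  circle_analytic phi -> (\int[mu]_x logabs phi x)%E != -oo%E ->
  mu.-integrable setT (logabs phi).
Proof.
move=> aphi; have [L [L0 lip]] := circle_analytic_lipschitz aphi.
have cphi := small_scale_lipschitz_continuous L0 lip.
have [B [B0 phiB]] := periodic1_continuous_bounded aphi.1 cphi.
apply: (@bounded_above_integrable _ _ _ _ _ (ln B)).
  by apply: measurable_logabs; exact: continuous_measurable_fun.
move=> x; rewrite /logabs; case: ifPn => [_|p0]; first exact: leNye.
by rewrite lee_fin ler_ln ?posrE ?normr_gt0.
Qed.

(** * Periodic orbits with almost the same average *)

(* The weight [u] penalises the visits to [|phi| < exp (- M)]; its integral is small
   because [ln |phi|] is integrable. *)
Lemma exists_periodic_average_ge (R : realType) (q : nat) (phi : R -> R)
    (mu : probability R R) (I e : R) :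
  (2 <= q)%N -> circle_analytic phi -> invariant_measures q mu ->
  (\int[mu]_x logabs phi x)%E = I%:E -> 0 < e ->
  exists (p : R) (n : nat), [/\ circle p, iter n.+1 (Tmap q) p = p,
    forall k, (k < n.+1)%N -> phi (iter k (Tmap q) p) != 0 &
    (I - e) * n.+1%:R <= \sum_(0 <= k < n.+1) ln `|phi (iter k (Tmap q) p)|].
Proof.
move=> q2 aphi [muc muT] intI e0.
have [L [L0 lip]] := circle_analytic_lipschitz aphi.
have [per _] := aphi.
have cphi := small_scale_lipschitz_continuous L0 lip.
have [B [B0 phiB]] := periodic1_continuous_bounded per cphi.
have mphi : measurable_fun [set: R] phi by exact: continuous_measurable_fun.
pose g x := ln `|phi x|.
have mg : measurable_fun [set: R] g.
  by apply: (measurableT_comp (@measurable_ln R)); exact: measurableT_comp.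
have gB x : phi x != 0 -> g x <= ln B.
  by move=> p0; rewrite ler_ln ?posrE ?normr_gt0.
have logi : mu.-integrable setT (logabs phi).
  by apply: integrable_logabs => //; rewrite intI.
have /integrableP[mlog _] := logi.
(* At a zero of [phi], [g] takes the default value [ln 0 = 0] while [logabs phi] is [-oo];
   integrability makes the zeros a null set. *)
have gae : ae_eq mu setT (logabs phi) (EFin \o g).
  apply: filterS (integrable_ae measurableT logi) => x /(_ Logic.I).
  by rewrite /logabs/=; case: ifPn.
have mEg : measurable_fun [set: R] (EFin \o g) by exact/measurable_EFinP.
have gi : mu.-integrable setT (EFin \o g).
  apply: (le_integrable measurableT mEg _ logi) => x _; rewrite /logabs.
  by case: ifPn => // _; rewrite leey.
have intg : (\int[mu]_x (g x)%:E = I%:E)%E.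
  by rewrite -intI; apply: ae_eq_integral => //; exact: ae_eq_sym.
pose c : R := ln (3 / 2).
have c0 : 0 < c by rewrite ln_gt0//; lra.
(* [C] bounds [g - I + e] off the zeros of [phi]; adding 1 makes it positive. *)
pose C : R := `|ln B - I + e| + 1.
have C0 : 0 < C by rewrite ltr_wpDl.
have Cc : 0 < C / c by rewrite divr_gt0.
(* With the integral of [u] below this value, the penalty [C / c * u] costs less than [e / 2], so
   the integral of [F] exceeds [e / 2]. *)
have eta0 : 0 < e / 2 / (C / c) by rewrite !divr_gt0.
have [M [ui uM]] := exists_tail_integral_lt eta0 gi.
pose u x : R := Num.max 0 (- g x - M%:R).
pose F x := g x - I + e - C / c * u x.
have Fi : mu.-integrable setT (EFin \o F) /\ ((e / 4)%:E < \int[mu]_x (F x)%:E)%E.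
  have ci : mu.-integrable setT (EFin \o cst (e - I)) by exact: finite_measure_integrable_cst.
  have gci := integrableD measurableT gi ci.
  have cui := integrableZl measurableT (C / c) ui.
  have FE : EFin \o F =
      (((EFin \o g) \+ (EFin \o cst (e - I)%R)) \- (fun x => (C / c)%:E * (u x)%:E))%E.
    by apply/funext => x /=; rewrite -EFinB; congr (_%:E); rewrite /F; ring.
  have Fint : mu.-integrable setT (EFin \o F) by rewrite FE; exact: integrableB.
  split => //.
  rewrite -[X in (_ < integral _ _ X)%E]/(EFin \o F) FE integralB// integralD// integralZl//.
  rewrite intg probability_integral_cst.
  move: uM; rewrite -(fineK (integrable_fin_num _ ui))// -EFinM -!EFinD !lte_fin.
  rewrite ltr_pdivlMr// mulrC; lra.
have {Fi} [Fi eF] := Fi.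
(* The null set to be avoided: zeros of [phi] and points outside the fundamental domain. *)
pose Z : set R := phi @^-1` [set 0] `|` ~` @circle R.
have mZ0 : measurable (phi @^-1` [set 0]).
  by rewrite -[X in measurable X]setTI; apply: mphi.
have mcirc : measurable (@circle R).
  rewrite (_ : @circle R = `[0, 1[%classic); first exact: measurable_itv.
  by apply/seteqP; split => x; rewrite /circle/= in_itv.
have mZ : measurable Z by apply: measurableU => //; exact: measurableC.
have Z0 : mu Z = 0%E.
  apply/(negligibleP mu mZ); apply: negligibleU.
    apply: negligibleS (integrable_ae measurableT logi) => x /= phix /(_ Logic.I).
    by rewrite /logabs phix eqxx.
  apply/(negligibleP mu (measurableC mcirc)).
  have := probability_setC mu mcirc; rewrite muc subee// => ->//.
(* The two bounds ensure what shadowing needs, [2 * d < L^-1] and [4 * L * d * expR M <= 1]. *)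
pose d : R := Num.min (L^-1 / 4) (4 * L * expR M%:R)^-1.
have d0 : 0 < d by rewrite lt_min divr_gt0 ?invr_gt0//= ?mulr_gt0 ?expR_gt0.
pose K := (Num.truncn d^-1).+1.
have Kd : K%:R^-1 <= d.
  by rewrite invf_ple ?posrE// ltW// truncnS_gt.
(* [N] is chosen so that [K * (C + 3) < e / 4 * N]. The loop has to gain more than 3, which bounds
   the sum of the shadowing losses [(3 / 4) ^+ (n - k)]. *)
pose N := (Num.truncn (K%:R * (C + 3) / (e / 4))).+1.
have [x [xZ xF]] := exists_sum_iter_gt (measurable_Tmap q) muT Fi eF mZ Z0 (isT : (0 < N)%N).
have xphi k : (k < N)%N -> phi (iter k (Tmap q) x) != 0.
  by move=> kN; apply/eqP => h; apply: (xZ k kN); left.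
have xc k : (k < N)%N -> circle (iter k (Tmap q) x).
  by move=> kN; apply: contrapT => h; apply: (xZ k kN); right.
(* The colour is the index of the arc of length [1 / K] containing the point; on [circle] this index
   is below [K], so [inord] keeps it. *)
pose col k : 'I_K := inord (Num.truncn (K%:R * iter k (Tmap q) x)).
have [s [t [stN cst Sst vst]]] : exists s t, [/\ (s < t < N)%N, col s = col t,
    3 < \sum_(s <= k < t) (g (iter k (Tmap q) x) - I + e) &
    forall k, (k < t)%N -> u (iter k (Tmap q) x) <= c * (t - k)%:R].
  apply: (@exists_good_loop _ _ N _ _ col C) => //.
  - exact: ltW.
  - by move=> k; rewrite /u le_max lexx.
  - move=> k kN; have := gB _ (xphi k kN); have := ler_norm (ln B - I + e); rewrite /C; lra.
  - apply: le_lt_trans xF; rewrite card_ord [leRHS]mulrC -ler_pdivrMr ?divr_gt0// ltW//.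
    exact: truncnS_gt.
have [st tN] := andP stN.
have sN := ltn_trans st tN.
pose n := (t - s)%N; have n0 : (0 < n)%N by rewrite subn_gt0.
pose y := iter s (Tmap q) x.
have iy k : iter k (Tmap q) y = iter (k + s) (Tmap q) x by rewrite iterD.
have yt : iter n (Tmap q) y = iter t (Tmap q) x by rewrite iy subnK// ltnW.
have kst k : (k < n)%N -> (k + s < t)%N by rewrite ltn_subRL addnC.
have close : `|iter n (Tmap q) y - y| <= d.
  rewrite yt; apply: le_trans Kd.
  have K0 : 0 < K%:R :> R by rewrite ltr0n.
  have colE k : (k < N)%N ->
      (col k)%:R <= K%:R * iter k (Tmap q) x < (col k)%:R + 1.
    move=> kN; have /andP[x0 x1] := xc _ kN.
    have Kx0 : 0 <= K%:R * iter k (Tmap q) x by rewrite mulr_ge0.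
    rewrite /col inordK; first by rewrite natr1; exact: truncn_itv.
    by rewrite truncn_lt_nat// gtr_pMr.
  have := colE _ sN; have := colE _ tN; rewrite cst -/y.
  set j : R := (col t)%:R; set a : R := iter t _ x => ta sb.
  rewrite -[K%:R^-1]mul1r ler_pdivlMr// -[X in _ * X](gtr0_norm K0) -normrM ler_norml mulrBl.
  by apply/andP; split; lra.
have [p [cp Tp near]] : exists p : R, [/\ circle p, iter n (Tmap q) p = p &
    forall k, (k < n)%N -> phi (iter k (Tmap q) p) != 0 /\
    ln `|phi (iter k (Tmap q) y)| - (3 / 4) ^+ (n - k) <=
      ln `|phi (iter k (Tmap q) p)|].
  apply: (ln_shadowing (L := L) (M := M%:R) (d := d)) => //.
  - have : d <= L^-1 / 4 by rewrite ge_min lexx.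
    have : 0 < L^-1 by rewrite invr_gt0. 
    lra.
  - have : d <= (4 * L * expR M%:R)^-1 by rewrite ge_min lexx orbT.
    rewrite -[_^-1]mul1r ler_pdivlMr ?mulr_gt0 ?expR_gt0//; lra.
  - by move=> k /kst kt; rewrite iy xphi// (ltn_trans kt tN).
  - move=> k /kst/vst; rewrite iy /u ge_max => /andP[_].
    by rewrite addnC subnDA.
exists p, n.-1; rewrite prednK//; split => // [k /near[]//|].
(* The loop gains more than 3 over [I - e] per step and shadowing loses at most 3 in total, so the
   periodic orbit still averages at least [I - e]. *)
have : \sum_(0 <= k < n) (g (iter k (Tmap q) y) - I + e - (3 / 4) ^+ (n - k)) <=
    \sum_(0 <= k < n) (ln `|phi (iter k (Tmap q) p)| - (I - e)).
  apply: ler_sum_nat => k /andP[_ /near[_]]; rewrite /g; lra.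
rewrite !sumrB !sumr_const_nat subn0 -[I *+ n]mulr_natr -[e *+ n]mulr_natr.
have := sum_geometric_three_quarters R n.
move: Sst; rewrite -{1}[s]add0n big_addn -/n.
under eq_bigr do rewrite -iy.
lra.
Qed.

(** * Equality of the two suprema *)

Unset Implicit Arguments.

Theorem theorem2p1 (R : realType) (q : nat) (phi : R -> R) :
  (2 <= q)%N ->
  circle_analytic phi ->
  finitely_many_zeros phi ->
  sup_integral (invariant_measures q) (logabs phi)
  = sup_integral (periodic_measures q) (logabs phi).
Proof.
move=> q2 aphi _; apply/eqP; rewrite eq_le; apply/andP; split; last first.
  by apply: le_ereal_sup; apply: image_subset => mu [].
have [L [L0 lip]] := circle_analytic_lipschitz aphi.
have mlog : measurable_fun [set: R] (logabs phi).
  apply: measurable_logabs; apply: continuous_measurable_fun.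
  exact: small_scale_lipschitz_continuous L0 lip.
apply: ge_ereal_sup => _ [mu muq <-].
have [->|intN] := eqVneq (\int[mu]_x logabs phi x)%E -oo%E; first exact: leNye.
have intI := fineK (integrable_fin_num measurableT (integrable_logabs aphi intN)).
rewrite -intI; set I := fine _; apply/lee_addgt0Pr => e e0.
have [p [n [cp Tp phip avg]]] := exists_periodic_average_ge q2 aphi muq (esym intI) e0.
(* The competitor is the uniform measure on the orbit of [p]; its integral is the orbit average, at
   least [I - e]. *)
pose nu : probability R R := orbit_measure R (Tmap q) p n.
have nuq : invariant_measures q nu.
  split; last by move=> A _; exact: orbit_measure_preimage.
  apply: orbit_measure_full => -[|k] _ //; exact: Tmap_circle.
have nuP : periodic_measures q nu.
  split=> //; exists p, n.+1; split => //; split => //; split => //.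
  by apply: orbit_measure_full => k kn; exists k.
rewrite -leeBlDr//; apply: (@le_trans _ _ (\int[nu]_x logabs phi x)%E); last first.
  by apply: ereal_sup_ubound; exists nu.
rewrite (integral_orbit_measure (g := fun k => ln `|phi (iter k (Tmap q) p)|))//; last first.
  by move=> k /phip /negPf phik; rewrite /logabs phik.
by rewrite -EFinB lee_fin mulrC ler_pdivlMr ?ltr0n.
Qed.
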